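(* Let $\lambda\in K$ with $\lambda\neq 0$ and $|\lambda|\ne 1$. If $F$ is a two-dimensional map fixing $0$, analytic at $0$, whose Jacobian at $0$ has eigenvalues $1$ and $\lambda$, then $F$ is analytically equivalent to its PD-form.
   Context: $K$ is a complete, nontrivially valued non-archimedean field of characteristic $0$ with norm $|\cdot|$. Maps are given by pairs of power series in $K[[x,y]]$ with zero constant term; a map is analytic at $0$ if both series converge on some polydisc containing $0$. Two maps $F,G$ are analytically equivalent if $\Phi\circ F\circ \Phi^{-1}=G$ for some $\Phi$ fixing $0$, analytic at $0$ and locally invertible there. For a map $F$, $[F]^k_{(i,j)}$ denotes the coefficient of $x^iy^j$ in the $k$-th component. PD-form (Poincaré–Dulac form, also called PD-normal form): by a linear change of coordinates one assumes $F(x,y)=(\lambda_1x+O(2),\lambda_2y+O(2))$ with $\lambda_1=1$, $\lambda_2=\lambda$ (here $O(2)$ means terms of total degree $\geq 2$). Put $F_1=F$. For $m\ge 2$ let $H_m=\mathrm{Id}+P_m$, where $P_m$ is the homogeneous polynomial map of degree $m$ whose coefficients are, for $i+j=m$ and $k=1,2$, $[H_m]^k_{(i,j)}=[F_{m-1}]^k_{(i,j)}/(\lambda_k-\lambda_1^i\lambda_2^j)$ if the denominator is nonzero and $0$ if the denominator is zero; put $F_m=H_m\circ F_{m-1}\circ H_m^{-1}$. The coefficients of total degree $\leq m$ of $F_m$ do not change in later steps, and the PD-form of $F$ is the (a priori formal) limit $F_0$ of the $F_m$. For the present eigenvalues it has the form $F_0(x,y)=\bigl(x+\sum_{i\ge2}a_ix^i,\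 \lambda y(1+\sum_{j\ge1}b_jx^j)\bigr)$. *)

(* Defs.v *)
From mathcomp Require Import all_boot all_order all_algebra.
From mathcomp Require Import finmap.
From mathcomp Require Import reals.

Set Implicit Arguments.
Unset Strict Implicit.
Unset Printing Implicit Defensive.
Import Order.TTheory GRing.Theory Num.Theory.
Local Open Scope ring_scope.

Section ValuedField.
Variables (R : realType) (K : fieldType) (norm : K -> R).

Record nonarch_norm : Prop := NonarchNorm {
  nonarch_ge0 : forall x, 0 <= norm x;
  nonarch_eq0 : forall x, norm x = 0 <-> x = 0;
  nonarch_mul : forall x y, norm (x * y) = norm x * norm y;
  nonarch_add : forall x y, norm (x + y) <= Num.max (norm x) (norm y)
}.

Definition nontrivially_valued : Prop :=
  exists x : K, x != 0 /\ norm x != 1.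

Definition cauchy_seq (u : nat -> K) : Prop :=
  forall e : R, 0 < e ->
    exists N : nat, forall m n : nat,
      (N <= m)%N -> (N <= n)%N -> norm (u m - u n) < e.

Definition cvg_seq (u : nat -> K) (l : K) : Prop :=
  forall e : R, 0 < e ->
    exists N : nat, forall n : nat, (N <= n)%N -> norm (u n - l) < e.

Definition complete_norm : Prop :=
  forall u : nat -> K, cauchy_seq u -> exists l : K, cvg_seq u l.

(* Unordered convergence, i.e. along the net of finite subsets of nat * nat:
   for double series over a non-archimedean field this is the usual notion. *)
Definition double_series_cvg (a : nat -> nat -> K) : Prop :=
  exists s : K, forall e : R, 0 < e ->
    exists A0 : {fset nat * nat}, forall A : {fset nat * nat},
      (A0 `<=` A)%fset -> norm (\sum_(p <- A) a p.1 p.2 - s) < e.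

End ValuedField.

(* [f i j] is the coefficient of x^i y^j. *)
Definition ser (K : fieldType) : Type := nat -> nat -> K.

(* [F k i j] is the coefficient of x^i y^j in the k-th component; the
   components, and the variables x and y, are numbered 0 and 1. *)
Definition fmap2 (K : fieldType) : Type := 'I_2 -> ser K.

Section FormalMaps.
Variable K : fieldType.
Implicit Types (f g : ser K) (F G H : fmap2 K) (A : 'M[K]_2).

Definition ser_one : ser K := fun i j => ((i == 0%N) && (j == 0%N))%:R.

Definition ser_mul f g : ser K := fun i j =>
  \sum_(a < i.+1) \sum_(b < j.+1) f a b * g (i - a)%N (j - b)%N.

Definition ser_exp f (n : nat) : ser K := iter n (ser_mul f) ser_one.

Definition fixes0 F : Prop := forall k, F k 0%N 0%N = 0.

(* f(G_0, G_1) for a map G fixing 0. Then G_0^a G_1^b has no terms of total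
   degree less than a + b, so that cutting the sum at a, b <= i + j loses
   nothing. *)
Definition ser_subst f G : ser K := fun i j =>
  \sum_(a < (i + j).+1) \sum_(b < (i + j).+1)
    f a b * ser_mul (ser_exp (G 0) a) (ser_exp (G 1) b) i j.

Definition comp F G : fmap2 K := fun k => ser_subst (F k) G.

Definition lin_map A : fmap2 K := fun k i j =>
  if (i, j) == (1, 0)%N then A k 0
  else if (i, j) == (0, 1)%N then A k 1
  else 0.

Definition id_map : fmap2 K := lin_map 1%:M.

Definition jacobian F : 'M[K]_2 :=
  \matrix_(k, l) (if l == 0 then F k 1%N 0%N else F k 0%N 1%N).

Definition inverse_maps F G : Prop :=
  [/\ fixes0 F, fixes0 G, comp F G = id_map & comp G F = id_map].

(* The family lam lists the eigenvalues lambda_1, lambda_2. *)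
Definition pd_poly (lam : 'I_2 -> K) (m : nat) F : fmap2 K := fun k i j =>
  let d := lam k - lam 0 ^+ i * lam 1 ^+ j in
  if (i + j == m)%N && (d != 0) then F k i j / d else 0.

Definition pd_trans (lam : 'I_2 -> K) (m : nat) F : fmap2 K :=
  fun k i j => id_map k i j + pd_poly lam m F k i j.

(* Fs m is F_m for m >= 1; the value Fs 0 plays no role. *)
Definition pd_sequence (lam : 'I_2 -> K) F (Fs : nat -> fmap2 K) : Prop :=
  Fs 1%N = F /\
  forall m : nat, (2 <= m)%N ->
    let H := pd_trans lam m (Fs m.-1) in
    exists Hinv : fmap2 K,
      inverse_maps H Hinv /\ Fs m = comp (comp H (Fs m.-1)) Hinv.

Definition formal_limit (Fs : nat -> fmap2 K) F : Prop :=
  forall k i j, exists N : nat, forall m : nat, (N <= m)%N ->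
    Fs m k i j = F k i j.

Definition lin_conj A F : fmap2 K :=
  comp (comp (lin_map A) F) (lin_map (invmx A)).

(* The PD-form is only determined up to the choice of the linear coordinates
   that diagonalize the linear part, whence a relation. *)
Definition is_pd_form (lam : 'I_2 -> K) F F0 : Prop :=
  exists (A : 'M[K]_2) (Fs : nat -> fmap2 K),
    [/\ A \in unitmx,
        jacobian (lin_conj A F) = diag_mx (\row_k lam k),
        pd_sequence lam (lin_conj A F) Fs
      & formal_limit Fs F0].

End FormalMaps.

Section Analytic.
Variables (R : realType) (K : fieldType) (norm : K -> R).

Definition analytic0 (F : fmap2 K) : Prop :=
  exists r : 'I_2 -> R, (forall l, 0 < r l) /\
    forall x y : K, norm x < r 0 -> norm y < r 1 ->
      forall k, double_series_cvg norm (fun i j => F k i j * x ^+ i * y ^+ j).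

Definition analytically_equivalent (F G : fmap2 K) : Prop :=
  exists Phi Psi : fmap2 K,
    [/\ inverse_maps Phi Psi, analytic0 Phi, analytic0 Psi
      & comp (comp Phi F) Psi = G].

End Analytic.

Definition eigen_pair (K : fieldType) (l1 l2 : K) : 'I_2 -> K :=
  fun k => if k == 0 then l1 else l2.

(* Main.v *)
Require Import Defs.
From mathcomp Require Import all_boot all_order all_algebra.
From mathcomp Require Import finmap.
From mathcomp Require Import reals.
From mathcomp Require Import boolp zify ring lra.

(** Let [lam] be the family of eigenvalues, [lam 0 = 1] and [lam 1 = mu], and [L]
the diagonal linear part. A nonzero divisor [lam k - lam 0 ^+ i * lam 1 ^+ j]
is a difference of two powers of [mu], and distinct powers of [mu] have
distinct norms since [norm mu] is neither [0] nor [1]. In an ultrametric field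
such a difference has the norm of its larger term ([norm_sub_neq]), so that
there are no small divisors ([no_small_divisors_eigen_pair]).

The Gauss norm of a series on a polydisc is the supremum of the norms of its
weighted coefficients. It is ultrametric and submultiplicative. Hence, if the
components of a map have Gauss norms at most [u] and [v] on a polydisc, then
substituting this map turns a series with norm at most [B] on the polydisc of
radii [u], [v] into a series with norm at most [B] on the original one
([gauss_le_comp]). There is no loss of domain, in contrast with the Cauchy
estimates of the complex case; this is why the iteration converges although
the linear part is neither attracting nor repelling.

After shrinking the polydisc, of radius [r], the map is within [e * r] of [L],
with [e] at most the norm of each eigenvalue ([near_lin_shrink]). This estimate
is preserved by every step of the Poincare-Dulac iteration with the same [e]
and [r] ([near_lin_pd_step]). Indeed the map [H = Id + P] of the step and its
inverse [Q] preserve the polydisc. With [f = F - L],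

  [F o Q - L = - L o P o Q + f o Q],

and the lower bound [norm (lam k)] on the divisors bounds [L o P] by [e * r].
Then, with [G = F o Q], [H o G - L = (G - L) + P o G]. As [G] maps the polydisc
into the one with radii [norm (lam k) * r], the second lower bound on the
divisors bounds [P o G] by [e * r].

So the successive conjugations and their inverses all preserve one polydisc.
Their coefficients stabilize, the limits inherit the bound, and a series with
a finite Gauss norm converges on the open polydisc by completeness
([gauss_le_analytic]). These limits conjugate the map to its normal form
([pd_conj_limE]).

On the formal side, all identities are proved degree by degree: composites
only depend on the terms of bounded degree of their factors ([comp_agree]), so
that associativity of composition is inherited from polynomials ([compA]). *)

Set Implicit Arguments.
Unset Strict Implicit.
Unset Printing Implicit Defensive.

Import Order.TTheory GRing.Theory Num.Theory.
Local Open Scope ring_scope.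

Local Notation "F \co G" := (Defs.comp F G) (at level 40, left associativity).

(** * Agreement of series up to a degree *)

Section FormalSeries.
Variable K : fieldType.
Implicit Types (f g : ser K) (F G H P Q : fmap2 K) (p q : {poly {poly K}}).

Lemma map_ext F G : (forall k i j, F k i j = G k i j) -> F = G.
Proof.
by move=> FG; apply/funext => k; apply/funext => i; apply/funext => j.
Qed.

Definition agree n f g := forall i j, (i + j < n)%N -> f i j = g i j.

Definition order n f := agree n f (fun _ _ => 0).

Lemma agree_trans n f g h : agree n f g -> agree n g h -> agree n f h.
Proof. by move=> fg gh i j ij; rewrite fg ?gh. Qed.

Lemma agree_sym n f g : agree n f g -> agree n g f.
Proof. by move=> fg i j ij; rewrite fg. Qed.

Lemma agreeW m n f g : (m <= n)%N -> agree n f g -> agree m f g.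
Proof. by move=> mn fg i j ij; apply: fg; lia. Qed.

Lemma map_agree F G : (forall n k, agree n (F k) (G k)) -> F = G.
Proof. by move=> FG; apply: map_ext => k i j; apply: (FG (i + j).+1); lia. Qed.

Lemma order_one f : f 0%N 0%N = 0 -> order 1 f.
Proof. by move=> f0 [|i] [|j]. Qed.

(** Below degree [m + n], one of the two factors of each term vanishes. *)
Lemma order_mul m n f g :
  order m f -> order n g -> order (m + n) (ser_mul f g).
Proof.
move=> fm gn i j ij; rewrite /ser_mul big1// => a _; rewrite big1// => b _.
have [ab|ab] := ltnP (a + b) m; first by rewrite fm// mul0r.
by rewrite [g _ _]gn ?mulr0//; have := ltn_ord a; have := ltn_ord b; lia.
Qed.

Lemma order_exp f n : f 0%N 0%N = 0 -> order n (ser_exp f n).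
Proof.
move=> f0; elim: n => [|n IHn]; first by move=> i j.
by rewrite -[n.+1]add1n; apply: order_mul => //; apply: order_one.
Qed.

(** Agreement is measured relatively to the order: a factor that is only
known up to degree [n + m] is multiplied by terms of degree at least [m']. *)
Lemma agree_mul n m m' f f' g g' :
    order m f -> order m f' -> order m' g -> order m' g' ->
    agree (n + m) f f' -> agree (n + m') g g' ->
  agree (n + (m + m')) (ser_mul f g) (ser_mul f' g').
Proof.
move=> of_ of' og og' ff' gg' i j ij.
rewrite /ser_mul; apply: eq_bigr => a _; apply: eq_bigr => b _.
have [ai bj] := (ltn_ord a, ltn_ord b).
have [ab|ab] := ltnP (a + b) m; first by rewrite of_// of'// !mul0r.
have [ab'|ab'] := ltnP (i - a + (j - b)) m'; first by rewrite og// og'// !mulr0.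
by rewrite ff' ?gg'//; lia.
Qed.

Lemma agree_exp n a f f' : f 0%N 0%N = 0 -> f' 0%N 0%N = 0 ->
  agree n.+1 f f' -> agree (n + a) (ser_exp f a) (ser_exp f' a).
Proof.
move=> f0 f'0 ff'; elim: a => [|a IHa] //.
rewrite -[a.+1]add1n; apply: agree_mul => //.
- exact: order_one.
- exact: order_one.
- exact: order_exp.
- exact: order_exp.
- by rewrite addn1.
Qed.

Definition monom G a b := ser_mul (ser_exp (G 0) a) (ser_exp (G 1) b).

Lemma order_monom G a b : fixes0 G -> order (a + b) (monom G a b).
Proof. by move=> G0; apply: order_mul; apply: order_exp; apply: G0. Qed.

Lemma agree_monom n a b G G' : fixes0 G -> fixes0 G' ->
    (forall k, agree n.+1 (G k) (G' k)) ->
  agree (n + (a + b)) (monom G a b) (monom G' a b).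
Proof.
by move=> G0 G'0 GG'; apply: agree_mul;
  (apply: order_exp || apply: agree_exp) => //; (apply: G0 || apply: G'0).
Qed.

Lemma sum_ord_widen (V : nmodType) (m n : nat) (u : nat -> V) : (m <= n)%N ->
  (forall a, (m <= a)%N -> u a = 0) -> \sum_(a < n) u a = \sum_(a < m) u a.
Proof.
move=> mn u0; rewrite (big_ord_widen n u mn) [LHS](bigID (fun a : 'I_n => a < m)%N) /=.
by rewrite [X in _ + X]big1 ?addr0// => a; rewrite -leqNgt => /u0.
Qed.

Lemma ser_subst_wide n f G i j : fixes0 G -> (i + j < n)%N ->
  ser_subst f G i j = \sum_(a < n) \sum_(b < n) f a b * monom G a b i j.
Proof.
move=> G0 ijn.
have z a b : (i + j < a + b)%N -> f a b * monom G a b i j = 0.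
  by move=> ab; rewrite order_monom ?mulr0.
rewrite [RHS](@sum_ord_widen _ _ _
  (fun a => \sum_(b < n) f a b * monom G a b i j) ijn); last first.
  by move=> a ija; rewrite big1// => b _; apply: z; lia.
apply: eq_bigr => a _.
rewrite [RHS](@sum_ord_widen _ _ _ (fun b => f a b * monom G a b i j) ijn)// => b ijb.
by apply: z; lia.
Qed.

(** If the series has order at least [m >= 2], substitution gains [m - 1]
degrees of agreement. This is what makes the fixed point equation of the
inverse of [Id + P] contracting. The constant term is the same on both sides,
whence [maxn 1 m]. *)
Lemma ser_subst_agree n m f G G' : fixes0 G -> fixes0 G' -> order m f ->
    (forall k, agree n.+1 (G k) (G' k)) ->
  agree (n + maxn 1 m) (ser_subst f G) (ser_subst f G').
Proof.
move=> G0 G'0 fm GG' i j ij; apply: eq_bigr => a _; apply: eq_bigr => b _.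
have [ab|ab] := ltnP (a + b) m; first by rewrite fm// !mul0r.
congr (_ * _); have [|ab0] := posnP (a + b); last first.
  by apply: (@agree_monom n) => //; lia.
by case: (nat_of_ord a) (nat_of_ord b) => [|?] [|?].
Qed.

Lemma ser_subst_agreel n f f' G : fixes0 G -> agree n f f' ->
  agree n (ser_subst f G) (ser_subst f' G).
Proof.
move=> G0 ff' i j ij; apply: eq_bigr => a _; apply: eq_bigr => b _.
have [ab|ab] := ltnP (a + b) n; first by rewrite ff'.
by rewrite [ser_mul _ _ _ _]order_monom ?mulr0//; lia.
Qed.

(** Identities between composites may be checked degree by degree, on any maps
that agree with the given ones up to that degree. *)
Lemma comp_agree n F F' G G' : fixes0 G -> fixes0 G' ->
    (forall k, agree n (F k) (F' k)) -> (forall k, agree n (G k) (G' k)) ->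
  forall k, agree n ((F \co G) k) ((F' \co G') k).
Proof.
case: n => [|n] G0 G'0 FF' GG' k; first by move=> i j.
apply: (agree_trans (ser_subst_agreel G0 (FF' k))).
by rewrite -[n.+1]addn1; apply: (@ser_subst_agree n 0).
Qed.

(** * Associativity of composition *)

Definition poly_ser p : ser K := fun i j => p`_i`_j.

Definition trunc n f : {poly {poly K}} :=
  \poly_(i < n) \poly_(j < n) f i j.

Lemma agree_trunc n f : agree n (poly_ser (trunc n f)) f.
Proof. by move=> i j ij; rewrite /poly_ser !coef_poly !ifT ?coef_poly ?ifT//; lia. Qed.

Lemma poly_serM p q : poly_ser (p * q) = ser_mul (poly_ser p) (poly_ser q).
Proof.
apply/funext => i; apply/funext => j; rewrite /poly_ser coefM coef_sum.
by apply: eq_bigr => a _; rewrite coefM.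
Qed.

Lemma poly_ser1 : poly_ser 1 = ser_one K.
Proof.
apply/funext => i; apply/funext => j; rewrite /poly_ser /ser_one coef1.
by case: i => [|i] /=; rewrite ?coef1 ?coef0.
Qed.

Lemma poly_serX p n : poly_ser (p ^+ n) = ser_exp (poly_ser p) n.
Proof. by elim: n => [|n IHn]; rewrite ?poly_ser1// exprS poly_serM IHn. Qed.

Definition poly_map2 (g : 'I_2 -> {poly {poly K}}) : fmap2 K := fun k => poly_ser (g k).

Definition poly_subst_y (q : {poly {poly K}}) : {rmorphism {poly K} -> {poly {poly K}}} :=
  horner_morph (fun c => mulrC q ((polyC \o polyC) c)).

(** Substitution in polynomials as a ring morphism; the outer variable of
[{poly {poly K}}] is x and the inner one y. *)
Definition poly_subst (g : 'I_2 -> {poly {poly K}}) :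
    {rmorphism {poly {poly K}} -> {poly {poly K}}} :=
  horner_morph (fun c => mulrC (g 0) (poly_subst_y (g 1) c)).

Lemma poly2_bound p : {n | forall i j, (n <= maxn i j)%N -> p`_i`_j = 0}.
Proof.
exists (maxn (size p) (\max_(i < size p) size (p`_i)%R)) => i j.
have [si|si] := leqP (size p) i; first by rewrite (nth_default 0 si) coef0.
move=> le_ij; apply: nth_default; 
have := leq_bigmax (F := fun i : 'I_(size p) => size (p`_i)%R) (Ordinal si).
move: le_ij; rewrite geq_max => /andP[].
have [ij _|ji] := leqP i j; last by rewrite leqNgt si.
by move=> /[swap]; exact: leq_trans.
Qed.

Lemma horner_morph_wide (T : comNzRingType) (S : nzRingType)
    (h : {rmorphism S -> T}) (u : T) (c : commr_rmorph h u) (n : nat) (q : {poly S}) :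
  (size q <= n)%N -> horner_morph c q = \sum_(i < n) h q`_i * u ^+ i.
Proof.
move=> sq; rewrite /horner_morph (@horner_coef_wide _ n).
  by apply: eq_bigr => i _; rewrite coef_map.
exact: leq_trans (size_poly _ _) sq.
Qed.

Lemma poly_substE (g : 'I_2 -> {poly {poly K}}) p n :
    (forall i j, (n <= maxn i j)%N -> p`_i`_j = 0) ->
  poly_subst g p =
    \sum_(a < n) \sum_(b < n) (p`_a`_b)%:P%:P * (g 0 ^+ a * g 1 ^+ b).
Proof.
move=> pn; have -> : poly_subst g p = \sum_(a < n) poly_subst_y (g 1) p`_a * g 0 ^+ a.
  apply: horner_morph_wide; apply/leq_sizeP => i ni.
  by apply/polyP => j; rewrite coef0; apply: pn; lia.
apply: eq_bigr => a _.
have -> : poly_subst_y (g 1) p`_a = \sum_(b < n) (p`_a`_b)%:P%:P * g 1 ^+ b.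
  by apply: horner_morph_wide; apply/leq_sizeP => j nj; apply: pn; lia.
by rewrite mulr_suml; apply: eq_bigr => b _; rewrite -mulrA [g 0 ^+ _ * _]mulrC.
Qed.

Lemma poly_substC (g : 'I_2 -> {poly {poly K}}) (c : K) : poly_subst g c%:P%:P = c%:P%:P.
Proof. by transitivity (poly_subst_y (g 1) c%:P); apply: horner_morphC. Qed.

Lemma poly_substA (g h : 'I_2 -> {poly {poly K}}) p :
  poly_subst h (poly_subst g p) = poly_subst (fun k => poly_subst h (g k)) p.
Proof.
have [n pn] := poly2_bound p; rewrite !(poly_substE _ pn) rmorph_sum.
apply: eq_bigr => a _; rewrite rmorph_sum; apply: eq_bigr => b _.
by rewrite !rmorphM !rmorphXn poly_substC.
Qed.

Lemma poly_ser_subst (g : 'I_2 -> {poly {poly K}}) p : fixes0 (poly_map2 g) ->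
  poly_ser (poly_subst g p) = ser_subst (poly_ser p) (poly_map2 g).
Proof.
move=> g0; apply/funext => i; apply/funext => j.
have [n pn] := poly2_bound p.
have pm a b : (n + (i + j).+1 <= maxn a b)%N -> p`_a`_b = 0.
  by move=> ab; apply: pn; lia.
rewrite (ser_subst_wide _ g0 (leq_addl n _)) (poly_substE _ pm) /poly_ser.
rewrite !coef_sum; apply: eq_bigr => a _; rewrite !coef_sum; apply: eq_bigr => b _.
by rewrite !coefCM /monom -!poly_serX -poly_serM.
Qed.

Definition trunc_map n F : 'I_2 -> {poly {poly K}} := fun k => trunc n (F k).

Lemma fixes0_trunc n F : fixes0 F -> fixes0 (poly_map2 (trunc_map n.+1 F)).
Proof. by move=> F0 k; rewrite /poly_map2 agree_trunc. Qed.

Lemma fixes0_comp F G : fixes0 F -> fixes0 G -> fixes0 (F \co G).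
Proof.
move=> F0 G0 k; rewrite /Defs.comp /ser_subst big_ord1 big_ord1.
by rewrite F0 mul0r.
Qed.

(** Both sides agree, up to any given degree, with composites of truncations,
that is of polynomials, for which associativity says that two ring morphisms
coincide. *)
Lemma compA F G H : fixes0 F -> fixes0 G -> fixes0 H ->
  F \co G \co H = F \co (G \co H).
Proof.
move=> F0 G0 H0.
apply: map_agree => n k; apply: (agreeW (leqnSn n)); move: k.
pose T X := poly_map2 (trunc_map n.+1 X).
have aT X k : agree n.+1 (X k) (T X k) by apply/agree_sym/agree_trunc.
have T0 X : fixes0 X -> fixes0 (T X) by apply: fixes0_trunc.
have TE (g h : 'I_2 -> {poly {poly K}}) : fixes0 (poly_map2 h) ->
    poly_map2 g \co poly_map2 h = poly_map2 (fun k => poly_subst h (g k)).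
  by move=> h0; apply/funext => k; rewrite /Defs.comp -poly_ser_subst.
have TA : T F \co T G \co T H = T F \co (T G \co T H).
  have FG : T F \co T G = poly_map2 _ := TE _ _ (T0 _ G0).
  have GH : T G \co T H = poly_map2 _ := TE _ _ (T0 _ H0).
  have GH0 := fixes0_comp (T0 _ G0) (T0 _ H0).
  rewrite {1}FG {1}GH [LHS](TE _ _ (T0 _ H0)) [RHS]TE; last by rewrite -GH.
  by apply/funext => k; rewrite /poly_map2/= poly_substA.
have FG0 := fixes0_comp F0 G0; have TFG0 := fixes0_comp (T0 _ F0) (T0 _ G0).
have GH0 := fixes0_comp G0 H0; have TGH0 := fixes0_comp (T0 _ G0) (T0 _ H0).
have [TG0 TH0] := (T0 _ G0, T0 _ H0).
move=> k; apply: (@agree_trans _ _ ((T F \co T G \co T H) k)).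
  by do 2!apply: comp_agree => // ?.
by rewrite TA; apply/agree_sym; do 2!apply: comp_agree => // ?.
Qed.

(** * Linear maps, inverses and formal limits *)

Lemma ser_mul1 f : ser_mul (ser_one K) f = f.
Proof.
apply/funext => i; apply/funext => j; rewrite /ser_mul /ser_one big_ord_recl.
rewrite [X in _ + X]big1 => [|a _]; last by rewrite big1// => b _; rewrite mul0r.
rewrite big_ord_recl [X in _ + X + _]big1 => [|b _]; last by rewrite mul0r.
by rewrite !addr0 mul1r !subn0.
Qed.

Lemma ser_mulr1 f : ser_mul f (ser_one K) = f.
Proof.
apply/funext => i; apply/funext => j; rewrite /ser_mul /ser_one big_ord_recr/=.
rewrite [X in X + _]big1 => [|a _]; last first.
  by rewrite big1// => b _; rewrite subn_eq0 leqNgt ltn_ord mulr0.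
rewrite big_ord_recr/= [X in _ + (X + _)]big1 => [|b _]; last first.
  by rewrite !subn_eq0 [X in _ && X]leqNgt ltn_ord andbF mulr0.
by rewrite !add0r !subnn mulr1.
Qed.

Lemma lin_comp (A : 'M[K]_2) G k i j : fixes0 G ->
  (lin_map A \co G) k i j = A k 0 * G 0 i j + A k 1 * G 1 i j.
Proof.
move=> G0; have lt_n : (i + j < (i + j).+2)%N by [].
rewrite /Defs.comp (ser_subst_wide _ G0 lt_n) big_ord_recl big_ord_recl.
rewrite 2!big_ord_recl /= /lin_map/= mul0r add0r.
rewrite big1 => [|b _]; last by rewrite mul0r.
rewrite big_ord_recl/= [X in _ + (_ + X + _)]big1 => [|b _]; last by rewrite mul0r.
rewrite big1 => [|a _]; last by rewrite big1// => b _; rewrite mul0r.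
by rewrite /monom/= ser_mul1 !ser_mulr1 !addr0 addrC.
Qed.

Lemma comp_idl G : fixes0 G -> id_map K \co G = G.
Proof.
move=> G0; apply: map_ext => k i j; rewrite lin_comp// !mxE.
by case: k => [[|[|//]] hk] /=; rewrite !(mul0r, mul1r, addr0, add0r);
  congr (G _ i j); apply: val_inj.
Qed.

Lemma monom_id a b i j : monom (id_map K) a b i j = ((i == a) && (j == b))%:R.
Proof.
have -> : id_map K = poly_map2 (fun k => if k == 0 then 'X else 'X%:P).
  apply: map_ext => k i' j'; rewrite /poly_map2 /poly_ser /id_map /lin_map !mxE.
  by case: k => [[|[|//]] hk]; case: i' => [|[|i']]; case: j' => [|[|j']];
    rewrite ?coefX ?coefC/= ?coef0 ?coef1 ?coefX.
rewrite /monom -!poly_serX -poly_serM /= /poly_ser -polyC_exp coefMC coefXn.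
by case: eqP => _; rewrite ?mul1r ?mul0r ?coef0// coefXn.
Qed.

Lemma comp_idr F : F \co id_map K = F.
Proof.
apply: map_ext => k i j; rewrite /Defs.comp /ser_subst.
under eq_bigr do under eq_bigr do rewrite -/(monom _ _ _) monom_id.
have [hi hj] : (i < (i + j).+1)%N /\ (j < (i + j).+1)%N by lia.
rewrite (bigD1 (Ordinal hi))//= (bigD1 (Ordinal hj))//= !eqxx mulr1.
rewrite !big1 ?addr0// => [a ai|b bj].
  by rewrite big1// => b _;
    rewrite -[i]/(val (Ordinal hi)) (inj_eq val_inj) eq_sym (negPf ai) mulr0.
by rewrite -[j]/(val (Ordinal hj)) (inj_eq val_inj) eq_sym (negPf bj) andbF mulr0.
Qed.

Lemma inverse_unique F G H : fixes0 F -> fixes0 G -> fixes0 H ->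
  G \co F = id_map K -> F \co H = id_map K -> G = H.
Proof.
by move=> F0 G0 H0 GF FH; rewrite -[G]comp_idr -FH -compA// GF comp_idl.
Qed.

Lemma inverse_comp F F' G G' : inverse_maps F F' -> inverse_maps G G' ->
  inverse_maps (F \co G) (G' \co F').
Proof.
move=> [F0 F'0 FF' F'F] [G0 G'0 GG' G'G]; split; do ?exact: fixes0_comp.
  rewrite compA//; last exact: fixes0_comp.
  by rewrite -[G \co _]compA// GG' comp_idl.
rewrite compA//; last exact: fixes0_comp.
by rewrite -[F' \co _]compA// F'F comp_idl.
Qed.

Lemma lin_mul (A B : 'M[K]_2) : lin_map A \co lin_map B = lin_map (A *m B).
Proof.
apply: map_ext => k i j; rewrite lin_comp// /lin_map !mxE !big_ord_recl !big_ord0 !addr0.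
have -> : lift ord0 ord0 = 1 :> 'I_2 by apply: val_inj.
by case: ((i, j) == (1, 0)%N); case: ((i, j) == (0, 1)%N); rewrite ?mulr0 ?addr0.
Qed.

Lemma inverse_lin (A : 'M[K]_2) : A \in unitmx ->
  inverse_maps (lin_map A) (lin_map (invmx A)).
Proof. by move=> uA; split; rewrite ?lin_mul ?mulmxV ?mulVmx. Qed.

Lemma inverse_id : inverse_maps (id_map K) (id_map K).
Proof. by split; rewrite ?comp_idr. Qed.

Lemma agree_jacobian F : fixes0 F -> forall k, agree 2 (F k) (lin_map (jacobian F) k).
Proof.
move=> F0 k [|[|i]] [|[|j]] //= _; rewrite ?F0// /lin_map/= !mxE//.
Qed.

Lemma eq_jacobian F G : (forall k, agree 2 (F k) (G k)) -> jacobian F = jacobian G.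
Proof. by move=> FG; apply/matrixP => k l; rewrite !mxE; case: ifP => _; apply: FG. Qed.

Lemma jacobian_lin (A : 'M[K]_2) : jacobian (lin_map A) = A.
Proof.
apply/matrixP => k [[|[|//]] hl]; rewrite !mxE /lin_map /=; congr (A _ _); exact: val_inj.
Qed.

Lemma jacobian_comp F G : fixes0 F -> fixes0 G ->
  jacobian (F \co G) = jacobian F *m jacobian G.
Proof.
move=> F0 G0; rewrite -[RHS]jacobian_lin -lin_mul.
by apply: eq_jacobian; apply: comp_agree => //; apply: agree_jacobian.
Qed.

Definition perturb P : fmap2 K := fun k i j => id_map K k i j + P k i j.

Lemma comp_addl F P Q k i j :
  ((fun k i j => F k i j + P k i j) \co Q) k i j = (F \co Q) k i j + (P \co Q) k i j.
Proof.
rewrite /Defs.comp /ser_subst -big_split; apply: eq_bigr => a _.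
by rewrite -big_split; apply: eq_bigr => b _; rewrite mulrDl.
Qed.

Lemma perturb_comp P Q k i j : fixes0 Q ->
  (perturb P \co Q) k i j = Q k i j + (P \co Q) k i j.
Proof. by move=> Q0; rewrite comp_addl comp_idl. Qed.

Lemma order_comp m P Q : fixes0 Q -> (forall k, order m (P k)) ->
  forall k, order m ((P \co Q) k).
Proof.
move=> Q0 Pm k; apply: (agree_trans (ser_subst_agreel Q0 (Pm k))) => i j _.
by rewrite /ser_subst big1// => a _; rewrite big1// => b _; rewrite mul0r.
Qed.

(** The intended sequences have constant coefficients of degree [n] from the
index [n] on, so that the diagonal choice picks the eventual value. *)
Definition formal_lim (Xs : nat -> fmap2 K) : fmap2 K := fun k i j => Xs (i + j)%N k i j.

Section FormalLimit.
Variable Xs : nat -> fmap2 K.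
Hypothesis Xs_agree : forall n k, agree n.+1 (Xs n.+1 k) (Xs n k).

Lemma formal_lim_agree n k : agree n.+1 (formal_lim Xs k) (Xs n k).
Proof.
have Xs_le m d : agree m.+1 (Xs (d + m)%N k) (Xs m k).
  elim: d => [|d IHd]; first by move=> i j.
  by rewrite addSn; apply: (agree_trans _ IHd); apply: (agreeW _ (@Xs_agree _ _)); lia.
move=> i j ij; rewrite /formal_lim -(Xs_le _ (n - (i + j))%N)//.
by rewrite subnK.
Qed.

Lemma fixes0_lim : (forall n, fixes0 (Xs n)) -> fixes0 (formal_lim Xs).
Proof. by move=> Xs0 k; apply: Xs0. Qed.

End FormalLimit.

Lemma eq_lim Xs F : (forall n k, agree n.+1 (F k) (Xs n k)) -> F = formal_lim Xs.
Proof. by move=> FX; apply: map_ext => k i j; apply: FX. Qed.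

(** The inverse of [Id + P] is the fixed point of [Q |-> Id - P o Q]. *)
Definition inv_step P Q : fmap2 K := fun k i j => id_map K k i j - (P \co Q) k i j.

Definition inv_iter P n := iter n (inv_step P) (id_map K).

Definition perturb_inv P : fmap2 K := formal_lim (inv_iter P).

Section PerturbationInverse.
Variable P : fmap2 K.
Hypothesis P2 : forall k, order 2 (P k).

Lemma fixes0_order : fixes0 P.
Proof. by move=> k; apply: P2. Qed.

Lemma fixes0_perturb : fixes0 (perturb P).
Proof. by move=> k; rewrite /perturb fixes0_order addr0. Qed.

Lemma fixes0_inv_step Q : fixes0 Q -> fixes0 (inv_step P Q).
Proof.
by move=> Q0 k; rewrite /inv_step fixes0_comp// ?subr0//; exact: fixes0_order.
Qed.

Lemma inv_step_agree n Q Q' : fixes0 Q -> fixes0 Q' ->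
    (forall k, agree n.+1 (Q k) (Q' k)) ->
  forall k, agree n.+2 (inv_step P Q k) (inv_step P Q' k).
Proof.
move=> Q0 Q'0 QQ' k i j ij; rewrite /inv_step; congr (_ - _).
by apply: (@ser_subst_agree n 2) => //; rewrite addn2.
Qed.

Lemma fixes0_inv_iter n : fixes0 (inv_iter P n).
Proof. by elim: n => [|n IHn]//; apply: fixes0_inv_step. Qed.

Lemma inv_iter_agree n k : agree n.+1 (inv_iter P n.+1 k) (inv_iter P n k).
Proof.
elim: n k => [|n IHn] k; last first.
  exact: (inv_step_agree (fixes0_inv_iter n.+1) (fixes0_inv_iter n) IHn).
move=> i j; rewrite ltnS leqn0 addn_eq0 => /andP[/eqP-> /eqP->].
by rewrite (fixes0_inv_iter 1).
Qed.

Lemma fixes0_perturb_inv : fixes0 (perturb_inv P).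
Proof. exact: fixes0_lim fixes0_inv_iter. Qed.

Lemma perturb_invE : perturb_inv P = inv_step P (perturb_inv P).
Proof.
apply/esym/eq_lim => n k; apply: (agree_trans _ (@inv_iter_agree n k)).
apply: (@agreeW _ n.+2) => //.
apply: (@inv_step_agree n _ (inv_iter P n)).
- exact: fixes0_perturb_inv.
- exact: fixes0_inv_iter.
- exact: (formal_lim_agree (@inv_iter_agree)).
Qed.

Lemma perturb_invr : perturb P \co perturb_inv P = id_map K.
Proof.
apply: map_ext => k i j; rewrite perturb_comp; last exact: fixes0_perturb_inv.
by rewrite [in X in X + _]perturb_invE subrK.
Qed.

End PerturbationInverse.

(** The right inverse of [Id + P] is again of the form [Id + P'] and so has a
right inverse too, which must be [Id + P]. *)
Lemma inverse_perturb P : (forall k, order 2 (P k)) ->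
  inverse_maps (perturb P) (perturb_inv P).
Proof.
move=> P2; have Q0 := fixes0_perturb_inv P2; have H0 := fixes0_perturb P2.
have HQ := perturb_invr P2; split=> //.
pose P' : fmap2 K := fun k i j => - (P \co perturb_inv P) k i j.
have P'2 k : order 2 (P' k).
  by move=> i j ij; rewrite /P' (order_comp Q0 P2)// oppr0.
have QE : perturb_inv P = perturb P' by rewrite {1}perturb_invE.
have QR : perturb_inv P \co perturb_inv P' = id_map K by rewrite QE; apply: perturb_invr.
by rewrite (inverse_unique Q0 H0 (fixes0_perturb_inv P'2) HQ QR).
Qed.

(** * The Poincare-Dulac iteration *)

Section PoincareDulac.
Variable lam : 'I_2 -> K.

Definition pd_step m F : fmap2 K :=
  pd_trans lam m F \co F \co perturb_inv (pd_poly lam m F).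

(** Steps are numbered by the degree that they normalize, from [2] on, so the
term of index [n] is normalized up to degree [n + 1]. *)
Fixpoint pd_iter F n : fmap2 K :=
  if n is n'.+1 then pd_step n'.+2 (pd_iter F n') else F.

Lemma order_pd_poly m F k : order m (pd_poly lam m F k).
Proof.
by move=> i j ij; rewrite /pd_poly ifF//; apply/negbTE; rewrite negb_and; apply/orP; left; lia.
Qed.

Lemma order2_pd_poly m F k : order 2 (pd_poly lam m.+2 F k).
Proof. exact: agreeW (@order_pd_poly m.+2 F k). Qed.

Lemma inverse_pd_trans m F :
  inverse_maps (pd_trans lam m.+2 F) (perturb_inv (pd_poly lam m.+2 F)).
Proof. exact/inverse_perturb/order2_pd_poly. Qed.

Lemma pd_trans_agree m F k : agree m (pd_trans lam m F k) (id_map K k).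
Proof. by move=> i j ij; rewrite /pd_trans order_pd_poly ?addr0. Qed.

Lemma pd_inv_agree m F k : agree m.+2 (perturb_inv (pd_poly lam m.+2 F) k) (id_map K k).
Proof.
have [H0 Q0 HQ _] := inverse_pd_trans m F.
have : agree m.+2 ((id_map K \co perturb_inv (pd_poly lam m.+2 F)) k)
    ((pd_trans lam m.+2 F \co perturb_inv (pd_poly lam m.+2 F)) k).
  by apply: comp_agree => // k'; apply/agree_sym/(@pd_trans_agree m.+2).
by rewrite HQ comp_idl.
Qed.

Lemma fixes0_pd_step m F : fixes0 F -> fixes0 (pd_step m.+2 F).
Proof.
by move=> F0; have [H0 Q0 _ _] := inverse_pd_trans m F; do 2?apply: fixes0_comp.
Qed.

Lemma fixes0_pd_iter F n : fixes0 F -> fixes0 (pd_iter F n).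
Proof. by move=> F0; elim: n => //= n; apply: fixes0_pd_step. Qed.

Lemma pd_iter_agree F n k : fixes0 F -> agree n.+1 (pd_iter F n.+1 k) (pd_iter F n k).
Proof.
move=> F0; have Fn0 := fixes0_pd_iter n F0.
have [H0 Q0 _ _] := inverse_pd_trans n (pd_iter F n).
rewrite -[pd_iter F n in X in agree _ _ X]comp_idr.
rewrite -[pd_iter F n in X in agree _ _ X]comp_idl//.
apply: (@agreeW _ n.+2) => //.
apply: comp_agree => // k'; last exact: pd_inv_agree.
by apply: comp_agree => // k''; apply: pd_trans_agree.
Qed.

(** Inverses being unique, so are the maps of the Poincare-Dulac sequence. *)
Lemma pd_sequenceP F Fs : fixes0 F -> pd_sequence lam F Fs ->
  forall n, Fs n.+1 = pd_iter F n.
Proof.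
move=> F0 [F1 FS]; elim=> [//|n IHn].
have /= := FS n.+2 isT; rewrite IHn => -[Hinv [[H0 Hinv0 HHinv HinvH] ->]].
have [_ Q0 HQ QH] := inverse_pd_trans n (pd_iter F n).
by rewrite (inverse_unique H0 Hinv0 Q0 HinvH HQ).
Qed.

Lemma pd_sequence_iter F : pd_sequence lam F (fun m => pd_iter F m.-1).
Proof.
split=> // -[|[|m]] // _ H; exists (perturb_inv (pd_poly lam m.+2 (pd_iter F m))).
by split=> //; apply: inverse_pd_trans.
Qed.

Definition pd_form F := formal_lim (pd_iter F).

Fixpoint pd_conj F n : fmap2 K :=
  if n is n'.+1 then pd_trans lam n'.+2 (pd_iter F n') \co pd_conj F n'
  else id_map K.

Fixpoint pd_conj_inv F n : fmap2 K :=
  if n is n'.+1 then pd_conj_inv F n' \co perturb_inv (pd_poly lam n'.+2 (pd_iter F n'))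
  else id_map K.

Lemma inverse_pd_conj F n : inverse_maps (pd_conj F n) (pd_conj_inv F n).
Proof.
elim: n => [|n IHn] /=; first exact: inverse_id.
by apply: inverse_comp => //; apply: inverse_pd_trans.
Qed.

Lemma pd_conjE F n : fixes0 F -> pd_conj F n \co F \co pd_conj_inv F n = pd_iter F n.
Proof.
move=> F0; elim: n => [|n IHn] /=; first by rewrite comp_idr comp_idl.
have [H0 Q0 _ _] := inverse_pd_trans n (pd_iter F n).
have [C0 D0 _ _] := inverse_pd_conj F n.
have CF0 := fixes0_comp C0 F0; have HCF0 := fixes0_comp H0 CF0.
rewrite /pd_step; move: (pd_trans _ _ _) (perturb_inv _) => H Q in H0 Q0 HCF0 *.
by rewrite -IHn [H \co _ \co F]compA// -[LHS]compA// [H \co _ \co _]compA.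
Qed.

Lemma pd_conj_agree F n k : agree n.+1 (pd_conj F n.+1 k) (pd_conj F n k).
Proof.
have [C0 D0 _ _] := inverse_pd_conj F n.
apply: (@agreeW _ n.+2) => //; rewrite -[in X in agree _ _ X](comp_idl C0).
by apply: comp_agree => // k'; apply: pd_trans_agree.
Qed.

Lemma pd_conj_inv_agree F n k : agree n.+1 (pd_conj_inv F n.+1 k) (pd_conj_inv F n k).
Proof.
have [C0 D0 _ _] := inverse_pd_conj F n.
have [H0 Q0 _ _] := inverse_pd_trans n (pd_iter F n).
apply: (@agreeW _ n.+2) => //; rewrite -[in X in agree _ _ X](comp_idr (pd_conj_inv F n)).
by apply: comp_agree => // k'; apply: pd_inv_agree.
Qed.

Definition pd_conj_lim F := formal_lim (pd_conj F).
Definition pd_conj_inv_lim F := formal_lim (pd_conj_inv F).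

Lemma inverse_pd_conj_lim F : inverse_maps (pd_conj_lim F) (pd_conj_inv_lim F).
Proof.
have C0 n : fixes0 (pd_conj F n) by have [] := inverse_pd_conj F n.
have D0 n : fixes0 (pd_conj_inv F n) by have [] := inverse_pd_conj F n.
have L0 : fixes0 (pd_conj_lim F) by apply: fixes0_lim.
have M0 : fixes0 (pd_conj_inv_lim F) by apply: fixes0_lim.
have aC := formal_lim_agree (@pd_conj_agree F).
have aD := formal_lim_agree (@pd_conj_inv_agree F).
split=> //; apply: map_agree => n k; apply: (@agreeW _ n.+1) => //.
  by have [_ _ <- _] := inverse_pd_conj F n; apply: comp_agree => // k';
    [exact: aC|exact: aD].
by have [_ _ _ <-] := inverse_pd_conj F n; apply: comp_agree => // k';
    [exact: aD|exact: aC].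
Qed.

Lemma pd_conj_limE F : fixes0 F -> pd_conj_lim F \co F \co pd_conj_inv_lim F = pd_form F.
Proof.
move=> F0; have [L0 M0 _ _] := inverse_pd_conj_lim F.
apply: eq_lim => n k; rewrite -pd_conjE//.
have [C0 D0 _ _] := inverse_pd_conj F n.
apply: comp_agree => // [k'|k']; last exact: (formal_lim_agree (@pd_conj_inv_agree F)).
by apply: comp_agree => // k''; apply: (formal_lim_agree (@pd_conj_agree F)).
Qed.

Lemma formal_limit_pd_form F Fs G : fixes0 F -> pd_sequence lam F Fs ->
  formal_limit Fs G -> G = pd_form F.
Proof.
move=> F0 /(pd_sequenceP F0) FsE FsG; apply: map_ext => k i j.
have [N GN] := FsG k i j; rewrite -(GN (N + (i + j)).+1); last by lia.
rewrite FsE; apply/esym.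
apply: (formal_lim_agree (fun n k => @pd_iter_agree F n k F0)); lia.
Qed.

End PoincareDulac.

End FormalSeries.

(** * Gauss norms *)

(** Bernoulli's inequality gives [th ^+ n <= (1 + n * (1 - th))^-1]. *)
Lemma expr_small (R : realType) (th B e : R) :
  0 <= th -> th < 1 -> 0 <= B -> 0 < e -> exists n : nat, B * th ^+ n < e.
Proof.
move=> th0 th1 B0 e0; pose h := 1 - th; have h0 : 0 < h by rewrite subr_gt0.
have bernoulli n : th ^+ n * (1 + n%:R * h) <= 1.
  elim: n => [|n IHn]; first by rewrite mul0r addr0 mulr1.
  apply: le_trans IHn; rewrite exprSr -mulrA ler_wpM2l ?exprn_ge0//.
  rewrite -natr1 -[th in leLHS](subKr 1) -/h -subr_ge0.
  have -> : 1 + n%:R * h - (1 - h) * (1 + (n%:R + 1) * h) = (n%:R + 1) * h ^+ 2 by ring.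
  by rewrite mulr_ge0 ?addr_ge0// exprn_ge0// ltW.
have [n Bn] : exists n : nat, B / (e * h) < n%:R.
  by exists (Num.Def.archi_bound (B / (e * h)));
    apply: archi_boundP; rewrite divr_ge0// mulr_ge0// ltW.
exists n; rewrite ltr_pdivrMr ?mulr_gt0// in Bn.
have := bernoulli n; have := exprn_ge0 n th0; set x := th ^+ n => x0 xn.
have n0 : 0 <= n%:R :> R by []. 
have : B * x * (1 + n%:R * h) <= B by rewrite -mulrA -[leRHS]mulr1 ler_wpM2l.
nra.
Qed.

Section GaussNorm.
Variables (R : realType) (K : fieldType) (norm : K -> R).
Hypothesis Knorm : nonarch_norm norm.

Let norm_ge0 x : 0 <= norm x. Proof. exact: nonarch_ge0. Qed.
Let normM x y : norm (x * y) = norm x * norm y. Proof. exact: nonarch_mul. Qed.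
Let norm_add x y : norm (x + y) <= Num.max (norm x) (norm y).
Proof. exact: nonarch_add. Qed.

Lemma norm0 : norm 0 = 0.
Proof. exact/(nonarch_eq0 Knorm). Qed.

Lemma norm_gt0 x : x != 0 -> 0 < norm x.
Proof.
by rewrite lt_def norm_ge0 andbT; apply: contra_neq => /(nonarch_eq0 Knorm).
Qed.

Lemma norm1 : norm 1 = 1.
Proof.
apply: (mulfI (lt0r_neq0 (norm_gt0 (oner_neq0 K)))).
by rewrite -normM !mulr1.
Qed.

Lemma normN x : norm (- x) = norm x.
Proof.
suff n1 : norm (-1) = 1 by rewrite -mulN1r normM n1 mul1r.
have := norm_ge0 (-1).
have : norm (-1) * norm (-1) = 1 by rewrite -normM mulrNN mulr1 norm1.
by move=> h h0; nra.
Qed.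

Lemma normX x n : norm (x ^+ n) = norm x ^+ n.
Proof. by elim: n => [|n IHn]; rewrite ?norm1// !exprS normM IHn. Qed.

Lemma normV x : norm x^-1 = (norm x)^-1.
Proof.
have [->|x0] := eqVneq x 0; first by rewrite invr0 norm0 invr0.
apply: (mulfI (lt0r_neq0 (norm_gt0 x0))).
by rewrite -normM !divff ?norm1// lt0r_neq0 ?norm_gt0.
Qed.

(** In an ultrametric triangle the two longest sides are equal. *)
Lemma norm_sub_neq x y : norm x != norm y ->
  norm x <= norm (x - y) /\ norm y <= norm (x - y).
Proof.
have := norm_add (x - y) y; have := norm_add (x - y) (- x).
rewrite addrAC subrr add0r subrK !normN.
set a := norm x; set b := norm y; set c := norm (x - y); rewrite !le_max.
by move=> /orP[] h1 /orP[] h2 ab; split=> //; move: ab; rewrite neq_lt => /orP[]; lra.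
Qed.

(** The weight [w] stays on the left, as the radii of polydiscs, hence the
weights, may vanish. *)
Lemma norm_sum_le (I : Type) (s : seq I) (Q : pred I) (u : I -> K) (w B : R) :
    0 <= w -> 0 <= B -> (forall i, Q i -> norm (u i) * w <= B) ->
  norm (\sum_(i <- s | Q i) u i) * w <= B.
Proof.
move=> w0 B0 uB; apply: (big_ind (fun x => norm x * w <= B)) => //.
  by rewrite norm0 mul0r.
move=> x y xB yB; apply: (le_trans (ler_wpM2r w0 (norm_add x y))).
by rewrite maxr_pMl// ge_max xB yB.
Qed.

Implicit Types (f g : ser K) (F G P : fmap2 K).

(** A bound on the Gauss norm of [f] for the radii [s] and [t], stated without
the supremum, which need not be finite. *)
Definition gauss_le (s t : R) f (B : R) :=
  forall i j, norm (f i j) * (s ^+ i * t ^+ j) <= B.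

Section Bounds.
Variables (s t : R).
Hypotheses (s0 : 0 <= s) (t0 : 0 <= t).

Let w0 i j : 0 <= s ^+ i * t ^+ j. Proof. by rewrite mulr_ge0 ?exprn_ge0. Qed.

Lemma gauss_le_ge0 f B : gauss_le s t f B -> 0 <= B.
Proof. by move=> /(_ 0 0)%N; apply: le_trans; rewrite mulr_ge0. Qed.

Lemma gauss_leW f B B' : B <= B' -> gauss_le s t f B -> gauss_le s t f B'.
Proof. by move=> BB' fB i j; apply: le_trans BB'. Qed.

Lemma eq_gauss_le f g B : (forall i j, f i j = g i j) ->
  gauss_le s t g B -> gauss_le s t f B.
Proof. by move=> fg gB i j; rewrite fg. Qed.

Lemma gauss_leD f g B : gauss_le s t f B -> gauss_le s t g B ->
  gauss_le s t (fun i j => f i j + g i j) B.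
Proof.
move=> fB gB i j; apply: (le_trans (ler_wpM2r (w0 i j) (norm_add _ _))).
by rewrite maxr_pMl// ge_max fB gB.
Qed.

Lemma gauss_leN f B : gauss_le s t f B -> gauss_le s t (fun i j => - f i j) B.
Proof. by move=> fB i j; rewrite normN. Qed.

Lemma gauss_leZ (c : K) f B : gauss_le s t f B ->
  gauss_le s t (fun i j => c * f i j) (norm c * B).
Proof. by move=> fB i j; rewrite normM -mulrA ler_wpM2l. Qed.

Lemma gauss_le_mul f g B C : gauss_le s t f B -> gauss_le s t g C ->
  gauss_le s t (ser_mul f g) (B * C).
Proof.
move=> fB gC i j; have [B0 C0] := (gauss_le_ge0 fB, gauss_le_ge0 gC).
have BC0 := mulr_ge0 B0 C0.
apply: norm_sum_le => // a _; apply: norm_sum_le => // b _.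
have -> : s ^+ i * t ^+ j = (s ^+ a * t ^+ b) * (s ^+ (i - a) * t ^+ (j - b)).
  by rewrite mulrACA -!exprD !subnKC// -ltnS.
by rewrite normM mulrACA; apply: ler_pM; rewrite ?(mulr_ge0 _ (w0 _ _))//.
Qed.

Lemma gauss_le_exp f B n : gauss_le s t f B -> gauss_le s t (ser_exp f n) (B ^+ n).
Proof.
move=> fB; elim: n => [|n IHn]; last by rewrite exprS; apply: gauss_le_mul.
move=> [|i] [|j]; rewrite /= /ser_one/= ?norm0 ?mul0r ?ler01//.
by rewrite norm1 mul1r mulr1.
Qed.

(** The ultrametric inequality loses nothing in the sum over the monomials of
[F k], each of which is bounded by the value of its norm at [u], [v]. *)
Lemma gauss_le_comp u v F G k B :
    gauss_le u v (F k) B -> gauss_le s t (G 0) u -> gauss_le s t (G 1) v ->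
  gauss_le s t ((F \co G) k) B.
Proof.
move=> FB G0u G1v i j.
have [u0 v0] := (gauss_le_ge0 G0u, gauss_le_ge0 G1v).
have B0 : 0 <= B by apply: le_trans (FB 0%N 0%N); rewrite !mulr1.
apply: norm_sum_le => // a _; apply: norm_sum_le => // b _.
apply: le_trans (FB a b); rewrite normM -mulrA ler_wpM2l//.
by apply: gauss_le_mul; apply: gauss_le_exp.
Qed.

End Bounds.

Lemma gauss_le_formal_lim s t (Xs : nat -> fmap2 K) k B :
  (forall n, gauss_le s t (Xs n k) B) -> gauss_le s t (formal_lim Xs k) B.
Proof. by move=> XsB i j; apply: XsB. Qed.

Lemma gauss_le_lin (A : 'M[K]_2) : exists2 C : R, 0 < C &
  forall s k, 0 <= s -> gauss_le s s (lin_map A k) (C * s).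
Proof.
exists (1 + \sum_(p : 'I_2 * 'I_2) norm (A p.1 p.2)) => [|s k s0 i j].
  by rewrite ltr_wpDr// sumr_ge0.
have Ak l : norm (A k l) * s <= (1 + \sum_p norm (A p.1 p.2)) * s.
  rewrite ler_wpM2r// (bigD1 (k, l))//= addrCA lerDl.
  by rewrite addr_ge0 ?sumr_ge0.
have C0 : 0 <= (1 + \sum_p norm (A p.1 p.2)) * s.
  by apply: le_trans (Ak 0); rewrite mulr_ge0.
by case: i j => [|[|i]] [|[|j]]; rewrite /lin_map/= ?norm0 ?mul0r// ?mulr1 ?mul1r ?expr1.
Qed.

(** * Convergence and coefficient bounds *)

(** Ultrametric sums are controlled by their terms, so unordered summability
only requires the terms to tend to [0]. *)
Lemma fset_sum_tail (a : nat * nat -> K) (A0 A : {fset nat * nat}) (d : R) :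
    0 <= d -> (A0 `<=` A)%fset -> (forall p, p \notin A0 -> norm (a p) <= d) ->
  norm (\sum_(p <- A) a p - \sum_(p <- A0) a p) <= d.
Proof.
move=> d0 A0A ad; rewrite (big_fsetID _ (mem A0)) /=.
have -> : [fset x | x in A & x \in A0]%fset = A0.
  by apply/fsetP => p; rewrite !inE andbC; case: (boolP (p \in A0)) => //= /(fsubsetP A0A).
rewrite addrAC subrr add0r -[leLHS]mulr1 big_seq_cond.
apply: norm_sum_le => // p; rewrite !inE mulr1 andbT => /andP[_]; exact: ad.
Qed.

Definition square n : {fset nat * nat} :=
  [fset p in [seq (i, j) | i <- iota 0 n, j <- iota 0 n]]%fset.

Lemma in_square n i j : ((i, j) \in square n) = (i < n)%N && (j < n)%N.
Proof.
rewrite inE/=; apply/allpairsP/andP => [[[a b]]|[hi hj]].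
  by rewrite !mem_iota !add0n /= => -[ha hb [-> ->]].
by exists (i, j); rewrite !mem_iota !add0n.
Qed.

(** Inside the polydisc the terms of degree at least [n] are bounded by
[B * th ^+ n] for some [th < 1]; the sums over squares are then a Cauchy
sequence and their limit is the unordered sum. *)
Lemma gauss_le_analytic (Kcomplete : complete_norm norm) F r B : 0 < r ->
  (forall k, gauss_le r r (F k) B) -> analytic0 norm F.
Proof.
move=> r0 FB; exists (fun _ => r); split=> // x y xr yr k.
pose th := Num.max (norm x) (norm y) / r.
have th0 : 0 <= th by rewrite divr_ge0 ?le_max ?norm_ge0// ltW.
have th1 : th < 1 by rewrite ltr_pdivrMr// mul1r gt_max xr.
have [xth yth] : norm x <= th * r /\ norm y <= th * r.
  by rewrite divfK ?gt_eqF// !le_max !lexx orbT.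
clearbody th.
have B0 : 0 <= B by apply: gauss_le_ge0 (FB 0); exact: ltW.
pose a (p : nat * nat) := F k p.1 p.2 * x ^+ p.1 * y ^+ p.2.
have a_small n p : p \notin square n -> norm (a p) <= B * th ^+ n.
  case: p => i j; rewrite in_square negb_and -!leqNgt => nij.
  have : norm (a (i, j)) <= B * (th ^+ (i + j)).
    rewrite /a/= !normM !normX -mulrA.
    apply: (@le_trans _ _ (norm (F k i j) * ((th * r) ^+ i * (th * r) ^+ j))).
      by rewrite ler_wpM2l// ler_pM ?exprn_ge0// lerXn2r ?nnegrE// (le_trans (norm_ge0 x)).
    rewrite !exprMn mulrACA -exprD [_ ^+ _ * _]mulrC mulrA ler_wpM2r ?exprn_ge0//.
    exact: FB.
  move/le_trans; apply; rewrite ler_wpM2l// ler_wiXn2l//; first exact: ltW.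
  by case/orP: nij; lia.
have tail n A : (square n `<=` A)%fset ->
    norm (\sum_(p <- A) a p - \sum_(p <- square n) a p) <= B * th ^+ n.
  by move=> nA; apply: fset_sum_tail => //; [rewrite mulr_ge0 ?exprn_ge0|exact: a_small].
have square_sub m n : (m <= n)%N -> (square m `<=` square n)%fset.
  by move=> mn; apply/fsubsetP => -[i j]; rewrite !in_square; lia.
have [|s sP] := Kcomplete (fun n => \sum_(p <- square n) a p).
  move=> e e0; have [N Ne] := expr_small th0 th1 B0 e0.
  exists N => m n Nm Nn; apply: le_lt_trans Ne.
  set S := fun n => \sum_(p <- square n) a p.
  have -> : S m - S n = (S m - S N) + - (S n - S N) by rewrite opprB addrA subrK.
  apply: le_trans (norm_add _ _) _; rewrite normN ge_max.
  by rewrite !tail//; exact: square_sub.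
exists s => e e0; have [N Ne] := expr_small th0 th1 B0 e0.
have [M sM] := sP _ e0; exists (square (maxn M N)) => A MA.
rewrite -(subrK (\sum_(p <- square (maxn M N)) a p) (\sum_(p <- A) a p)) -addrA.
apply: le_lt_trans (norm_add _ _) _; rewrite gt_max sM ?leq_maxl// andbT.
apply: le_lt_trans (tail _ _ MA) _; apply: le_lt_trans Ne.
by rewrite ler_wpM2l// ler_wiXn2l// ?leq_maxr//; exact: ltW.
Qed.

(** Beyond some finite set of indices, adding one term changes the partial sum
by less than [1]. *)
Lemma double_series_bounded (a : nat -> nat -> K) : double_series_cvg norm a ->
  exists2 B : R, 0 <= B & forall i j, norm (a i j) <= B.
Proof.
move=> [s /(_ 1 ltr01)[A0 sA0]].
exists (1 + \sum_(p <- A0) norm (a p.1 p.2)) => [|i j].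
  by rewrite addr_ge0 ?sumr_ge0.
have [A0ij|A0ij] := boolP ((i, j) \in A0).
  rewrite (big_fsetD1 (i, j))//= addrCA lerDl.
  by rewrite addr_ge0 ?sumr_ge0.
apply: ler_wpDr; first by rewrite sumr_ge0.
have := sA0 ((i, j) |` A0)%fset (fsubsetUr _ _); have := sA0 A0 (fsubset_refl _).
rewrite big_fsetU1//=; set S := \sum_(p <- A0) _ => S1 S2.
have -> : a i j = (a i j + S - s) + - (S - s) by ring.
by apply: le_trans (norm_add _ _) _; rewrite normN ge_max !ltW.
Qed.

Lemma exists_small (Knontrivial : nontrivially_valued norm) (e : R) : 0 < e ->
  exists2 z : K, 0 < norm z & norm z < e.
Proof.
move=> e0.
have [x x0 x1] : exists2 x : K, x != 0 & norm x < 1.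
  have [x [x0]] := Knontrivial; rewrite neq_lt => /orP[x1|x1]; first by exists x.
  by exists x^-1; rewrite ?invr_eq0// normV invf_lt1// norm_gt0.
have [n xn] := expr_small (norm_ge0 x) x1 ler01 e0.
by exists (x ^+ n); rewrite normX ?exprn_gt0 ?norm_gt0// -[ltLHS]mul1r.
Qed.

Lemma analytic_gauss_le (Knontrivial : nontrivially_valued norm) F :
  analytic0 norm F -> exists t B : R, 0 < t /\ forall k, gauss_le t t (F k) B.
Proof.
move=> [r [r0 Fr]].
have [|z z0 zr] := exists_small Knontrivial (e := Num.min (r 0) (r 1)).
  by rewrite lt_min !r0.
move: zr; rewrite lt_min => /andP[zr0 zr1].
have FB k : exists2 B : R, 0 <= B & gauss_le (norm z) (norm z) (F k) B.
  have [B B0 FB] := double_series_bounded (Fr z z zr0 zr1 k); exists B => // i j.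
  by rewrite -!normX -!normM mulrA.
have [[B0 B00 FB0] [B1 B10 FB1]] := (FB 0, FB 1).
exists (norm z), (B0 + B1); split=> // -[[|[|//]] hk].
  by apply: (@gauss_leW _ _ _ B0); [rewrite lerDl|have -> : Ordinal hk = 0 by apply: val_inj].
by apply: (@gauss_leW _ _ _ B1); [rewrite lerDr|have -> : Ordinal hk = 1 by apply: val_inj].
Qed.

(** * Normalization without small divisors *)

(** In an ultrametric field this says that [lam k] and the monomial in the
eigenvalues cannot cancel: a divisor is as large as the larger of its two
terms. Both bounds matter: the first one keeps the corrections small after
multiplication by [lam k], the second one after substitution of the linear
part. *)
Definition no_small_divisors (lam : 'I_2 -> K) :=
  forall k i j, lam k - lam 0 ^+ i * lam 1 ^+ j != 0 ->
  norm (lam k) <= norm (lam k - lam 0 ^+ i * lam 1 ^+ j) /\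
  norm (lam 0 ^+ i * lam 1 ^+ j) <= norm (lam k - lam 0 ^+ i * lam 1 ^+ j).

Section NoSmallDivisors.
Variables (lam : 'I_2 -> K) (e r : R).
Hypotheses (e0 : 0 < e) (r0 : 0 < r) (e_lam : forall k, e <= norm (lam k)).
Hypothesis divisor_ge : no_small_divisors lam.

Let r_ge0 : 0 <= r := ltW r0.
Let er_ge0 : 0 <= e * r. Proof. by rewrite mulr_ge0 ?ltW. Qed.
Let lam_gt0 k : 0 < norm (lam k). Proof. exact: lt_le_trans (e_lam k). Qed.
Let er_lam k : e * r <= norm (lam k) * r. Proof. by rewrite ler_wpM2r. Qed.

Definition Lin : fmap2 K := lin_map (diag_mx (\row_k lam k)).

Definition near_lin F := forall k, gauss_le r r (fun i j => F k i j - Lin k i j) (e * r).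

Lemma LinE k i j : Lin k i j = lam k * id_map K k i j.
Proof.
rewrite /Lin /id_map /lin_map !mxE.
by case: k => [[|[|//]] hk] /=; case: ((i, j) == (1, 0)%N); case: ((i, j) == (0, 1)%N);
  rewrite ?mulr1n ?mulr0n ?mulr1 ?mulr0.
Qed.

Lemma Lin_comp G k i j : fixes0 G -> (Lin \co G) k i j = lam k * G k i j.
Proof.
move=> G0; rewrite lin_comp// !mxE.
by case: k => [[|[|//]] hk] /=; rewrite ?mulr1n ?mulr0n ?(mul0r, addr0, add0r);
  congr (_ * G _ _ _); apply: val_inj.
Qed.

Lemma gauss_le_id k : gauss_le r r (id_map K k) r.
Proof.
move=> i j; rewrite /id_map /lin_map !mxE.
have n01 (b : bool) : norm (b%:R : K) * r <= r.
  by case: b; rewrite ?norm1 ?norm0 ?mul1r ?mul0r.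
by case: i j => [|[|i]] [|[|j]]; rewrite /= ?norm0 ?mul0r// ?mul1r ?mulr1 ?expr1 n01.
Qed.

Lemma gauss_le_Lin k : gauss_le r r (Lin k) (norm (lam k) * r).
Proof. by move=> i j; rewrite LinE; apply: gauss_leZ; apply: gauss_le_id. Qed.

Lemma near_lin_gauss_le F k : near_lin F -> gauss_le r r (F k) (norm (lam k) * r).
Proof.
move=> nF; apply: (@eq_gauss_le _ _ _ (fun i j => F k i j - Lin k i j + Lin k i j)).
  by move=> i j; rewrite subrK.
by apply: gauss_leD => //; [apply: gauss_leW (nF k)|apply: gauss_le_Lin].
Qed.

Section Step.
Variables (m : nat) (F : fmap2 K).
Hypotheses (F0 : fixes0 F) (nF : near_lin F).

Let P := pd_poly lam m.+2 F.
Let Q := perturb_inv P.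

(** Only degrees at least [2] occur, where [Lin lam] has no coefficients and the
bound on [F - Lin lam] is one on [F]; the constant [c] is the part of the
divisor that can be gained back. *)
Lemma norm_pd_poly k i j (c : R) : 0 <= c ->
    (lam k - lam 0 ^+ i * lam 1 ^+ j != 0 -> c <= norm (lam k - lam 0 ^+ i * lam 1 ^+ j)) ->
  c * norm (P k i j) * (r ^+ i * r ^+ j) <= e * r.
Proof.
move=> c0 cd; rewrite /P /pd_poly; case: ifP => [/andP[/eqP ijm d0]|_]; last first.
  by rewrite norm0 mulr0 mul0r.
have Lij : Lin k i j = 0.
  by move: ijm; rewrite /Lin /lin_map; case: i j {cd d0} => [|[|i]] [|[|j]].
apply: le_trans (nF k i j); rewrite Lij subr0 ler_wpM2r ?mulr_ge0 ?exprn_ge0//.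
by rewrite normM normV mulrCA ler_piMr// ler_pdivrMr ?mul1r ?cd// norm_gt0.
Qed.

Lemma gauss_le_pd_poly k : gauss_le r r (P k) (e * r / norm (lam k)).
Proof.
move=> i j; rewrite ler_pdivlMr// [leLHS]mulrC [leLHS]mulrA; apply: norm_pd_poly => //.
by case/divisor_ge.
Qed.

(** On the polydisc that contains the image of [F], which may be larger than
the one of radius [r], the growth of the monomials is compensated by that of
the divisors. *)
Lemma gauss_le_pd_poly_Lin k : gauss_le (norm (lam 0) * r) (norm (lam 1) * r) (P k) (e * r).
Proof.
move=> i j; rewrite !exprMn mulrACA -!normX -normM [leLHS]mulrA [norm _ * norm _]mulrC.
by apply: norm_pd_poly => //; case/divisor_ge.
Qed.

Let P_small k : gauss_le r r (P k) r.
Proof.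
apply: gauss_leW (gauss_le_pd_poly k); rewrite ler_pdivrMr// [r * _]mulrC.
exact: er_lam.
Qed.

Lemma gauss_le_pd_trans k : gauss_le r r (pd_trans lam m.+2 F k) r.
Proof. by apply: gauss_leD => //; apply: gauss_le_id. Qed.

Lemma gauss_le_pd_inv k : gauss_le r r (Q k) r.
Proof.
apply: gauss_le_formal_lim => n; elim: n k => [|n IHn] k; first exact: gauss_le_id.
apply: gauss_leD => //; first exact: gauss_le_id.
by apply: gauss_leN; apply: (@gauss_le_comp r r _ _ r r).
Qed.

(** With [f = F - Lin lam], the difference [F o Q - Lin lam] is the sum of
[Lin lam o (Q - Id) = - lam k * (P o Q)] and [f o Q]. *)
Lemma near_lin_comp_inv : near_lin (F \co Q).
Proof.
have P2 := @order2_pd_poly K lam m F.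
have Q0 : fixes0 Q := fixes0_perturb_inv P2.
move=> k; pose f : fmap2 K := fun k i j => F k i j - Lin k i j.
have FE i j : (F \co Q) k i j - Lin k i j =
    - (lam k * (P \co Q) k i j) + (f \co Q) k i j.
  have -> : F = fun k i j => Lin k i j + f k i j.
    by apply: map_ext => k' i' j'; rewrite /f addrC subrK.
  rewrite comp_addl Lin_comp// LinE addrAC; congr (_ + _).
  by rewrite -mulrBr {1}/Q (perturb_invE P2) /inv_step -/Q addrAC subrr add0r mulrN.
apply: (eq_gauss_le FE); apply: gauss_leD => //.
  apply: gauss_leN.
  have -> : e * r = norm (lam k) * (e * r / norm (lam k)).
    by rewrite mulrCA divff ?mulr1// gt_eqF.
  apply: gauss_leZ; apply: (@gauss_le_comp r r _ _ r r) => //; try exact: gauss_le_pd_inv.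
  exact: gauss_le_pd_poly.
by apply: (@gauss_le_comp r r _ _ r r) => //;
  [exact: nF|exact: gauss_le_pd_inv|exact: gauss_le_pd_inv].
Qed.

(** The error [e * r] does not deteriorate, which allows infinitely many
steps on one polydisc. *)
Lemma near_lin_pd_step : near_lin (pd_step lam m.+2 F).
Proof.
have [H0 Q0 _ _] := inverse_pd_trans lam m F.
have G0 : fixes0 (F \co Q) := fixes0_comp F0 Q0.
move=> k; apply: (@eq_gauss_le _ _ _ (fun i j =>
    (F \co Q) k i j - Lin k i j + (P \co (F \co Q)) k i j)) => [i j|].
  by rewrite /pd_step compA// perturb_comp// addrAC.
apply: gauss_leD => //; first exact: near_lin_comp_inv.
by apply: gauss_le_comp (gauss_le_pd_poly_Lin k) _ _ => //;
  exact/near_lin_gauss_le/near_lin_comp_inv.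
Qed.

End Step.

Variable F : fmap2 K.
Hypotheses (F0 : fixes0 F) (nF : near_lin F).

Lemma near_lin_pd_iter n : near_lin (pd_iter lam F n).
Proof.
by elim: n => //= n IHn; apply: near_lin_pd_step => //; exact: fixes0_pd_iter.
Qed.

Lemma gauss_le_pd_conj_lim k : gauss_le r r (pd_conj_lim lam F k) r.
Proof.
apply: gauss_le_formal_lim => n; elim: n k => [|n IHn] k; first exact: gauss_le_id.
apply: (@gauss_le_comp r r _ _ r r) => //.
exact/gauss_le_pd_trans/near_lin_pd_iter.
Qed.

Lemma gauss_le_pd_conj_inv_lim k : gauss_le r r (pd_conj_inv_lim lam F k) r.
Proof.
apply: gauss_le_formal_lim => n; elim: n k => [|n IHn] k; first exact: gauss_le_id.
by apply: (@gauss_le_comp r r _ _ r r) => //; exact/gauss_le_pd_inv/near_lin_pd_iter.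
Qed.

End NoSmallDivisors.

End GaussNorm.

(** * Analytic equivalence *)

Section Equivalence.
Variables (R : realType) (K : fieldType) (norm : K -> R).
Hypothesis Knorm : nonarch_norm norm.

(** The difference to the linear part starts in degree [2]: on passing from the
radius [u] to [th * u] its bound gains [th ^+ 2], while the target [e * r] only
loses a factor [th]. *)
Lemma near_lin_shrink (lam : 'I_2 -> K) (e u B : R) (F : fmap2 K) :
    0 < e -> 0 < u -> fixes0 F -> jacobian F = diag_mx (\row_k lam k) ->
    (forall k, gauss_le norm u u (F k) B) ->
  exists2 r : R, 0 < r & near_lin norm lam e r F.
Proof.
move=> e0 u0 F0 JF FB.
have B0 : 0 <= B by apply: gauss_le_ge0 (FB 0); rewrite ?ltW.
have eu0 : 0 < e * u by rewrite mulr_gt0.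
(* [B + 1] rather than [B], which may vanish. *)
pose th := Num.min 1 (e * u / (B + 1)).
have th0 : 0 < th by rewrite lt_min ltr01 divr_gt0// ltr_wpDl.
have th1 : th <= 1 by rewrite ge_min lexx.
have Bth : B * th <= e * u.
  have : th <= e * u / (B + 1) by rewrite ge_min lexx orbT.
  rewrite ler_pdivlMr ?ltr_wpDl// mulrC; apply: le_trans.
  by rewrite ler_wpM2r ?lerDl// ltW.
clearbody th; exists (th * u); first by rewrite mulr_gt0.
move=> k i j; have [ij|ij] := ltnP (i + j) 2.
  rewrite [F k i j](agree_jacobian F0)// JF subrr (norm0 Knorm) mul0r.
  by rewrite !mulr_ge0// ltW.
have -> : Lin lam k i j = 0.
  by move: ij; rewrite /Lin /lin_map; case: i j => [|[|i]] [|[|j]].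
rewrite subr0 !exprMn mulrACA -exprD [th ^+ _ * _]mulrC [leLHS]mulrA.
apply: (@le_trans _ _ (B * th ^+ 2)).
  apply: ler_pM; rewrite ?exprn_ge0 ?mulr_ge0 ?exprn_ge0
      ?(nonarch_ge0 Knorm) ?(ltW u0) ?(ltW th0)//.
    exact: FB.
  by rewrite ler_wiXn2l// ltW.
by rewrite expr2 mulrA [th * u]mulrC [leRHS]mulrA ler_wpM2r// ltW.
Qed.

(** The conjugation is the linear change of coordinates [A] followed by the
limit of the normalizing maps; it is analytic on a polydisc that [A] maps into
the one on which the normalizing maps are controlled. *)
Lemma analytically_equivalent_pd_form
    (Knontrivial : nontrivially_valued norm) (Kcomplete : complete_norm norm)
    (lam : 'I_2 -> K) (lam_neq0 : forall k, lam k != 0)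
    (divisor_ge : no_small_divisors norm lam)
    (F G : fmap2 K) :
  fixes0 F -> analytic0 norm F -> is_pd_form lam F G ->
  analytically_equivalent norm F G.
Proof.
move=> F0 Fan [A [Fs [uA JF' FsP FsG]]].
set F' := lin_conj A F in JF' FsP.
have LA0 : fixes0 (lin_map A) by [].
have LV0 : fixes0 (lin_map (invmx A)) by [].
have F'0 : fixes0 F' := fixes0_comp (fixes0_comp LA0 F0) LV0.
have [t [B [t0 FB]]] := analytic_gauss_le Knorm Knontrivial Fan.
have [C C0 CA] := gauss_le_lin Knorm A; have [D D0 DA] := gauss_le_lin Knorm (invmx A).
pose u := t / D; have u0 : 0 < u by rewrite divr_gt0.
have F'B k : gauss_le norm u u (F' k) (C * B).
  have uge0 := ltW u0.
  have FDB l : gauss_le norm u u ((F \co lin_map (invmx A)) l) B.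
    have Dt : t = D * u by rewrite mulrC divfK ?gt_eqF.
    by apply: gauss_le_comp (FB l) _ _ => //; rewrite Dt; apply: DA.
  rewrite /F' /lin_conj compA//; apply: gauss_le_comp (CA B k _) _ _ => //.
  exact: gauss_le_ge0 (FDB 0).
pose e := Num.min (norm (lam 0)) (norm (lam 1)).
have e0 : 0 < e by rewrite lt_min !(norm_gt0 Knorm).
have e_lam k : e <= norm (lam k).
  case: k => [[|[|//]] hk]; rewrite ge_min; apply/orP; [left|right].
    by rewrite (_ : Ordinal hk = 0)//; apply: val_inj.
  by rewrite (_ : Ordinal hk = 1)//; apply: val_inj.
have [r r0 nF'] := near_lin_shrink e0 u0 F'0 JF' F'B.
have rge0 := ltW r0.
have [L0 M0 LM ML] := inverse_pd_conj_lim lam F'.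
exists (pd_conj_lim lam F' \co lin_map A), (lin_map (invmx A) \co pd_conj_inv_lim lam F').
split.
- by apply: inverse_comp; [exact: inverse_pd_conj_lim|exact: inverse_lin].
- have rC0 : 0 < r / C by rewrite divr_gt0.
  apply: (gauss_le_analytic Knorm Kcomplete (r := r / C) (B := r)) => // k.
  have Cr : r = C * (r / C) by rewrite mulrC divfK ?gt_eqF.
  apply: gauss_le_comp (gauss_le_pd_conj_lim Knorm e0 r0 e_lam divisor_ge F'0 nF' k) _ _ => //;
    rewrite ?ltW//.
    by rewrite {3}Cr; apply: CA; apply: ltW.
  by rewrite {3}Cr; apply: CA; apply: ltW.
- apply: (gauss_le_analytic Knorm Kcomplete (r := r) (B := D * r)) => // k.
  apply: gauss_le_comp (DA r k rge0) _ _ => //;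
    exact: (gauss_le_pd_conj_inv_lim Knorm e0 r0 e_lam divisor_ge F'0 nF').
rewrite (formal_limit_pd_form F'0 FsP FsG) -pd_conj_limE// /F' /lin_conj.
have AF0 := fixes0_comp LA0 F0; have VM0 := fixes0_comp LV0 M0.
have LAF0 := fixes0_comp L0 AF0.
by rewrite [pd_conj_lim _ _ \co _ \co F]compA// -[LHS]compA//
  [_ \co _ \co lin_map (invmx A)]compA.
Qed.

End Equivalence.

Lemma diagonalize2 (K : fieldType) (J : 'M[K]_2) (lam : 'I_2 -> K) :
    (forall k, eigenvalue J (lam k)) -> lam 0 != lam 1 ->
  exists2 A : 'M[K]_2, A \in unitmx & A *m J *m invmx A = diag_mx (\row_k lam k).
Proof.
move=> Jlam lam01.
have [v0 Jv0 v0_neq0] := eigenvalueP (Jlam 0).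
have [v1 Jv1 v1_neq0] := eigenvalueP (Jlam 1).
pose A : 'M[K]_2 := \matrix_(k, l) (if k == 0 then v0 0 l else v1 0 l).
have AE (w : 'rV[K]_2) : w *m A = w 0 0 *: v0 + w 0 1 *: v1.
  apply/rowP => l; rewrite !mxE !big_ord_recl big_ord0 addr0 !mxE/=.
  by have -> : lift ord0 ord0 = 1 :> 'I_2 by apply: val_inj.
have uA : A \in unitmx.
  rewrite unitmxE unitfE; apply/negP => /det0P[w w_neq0]; rewrite AE => wA.
  have wAJ : (w 0 0 *: v0 + w 0 1 *: v1) *m J = 0 by rewrite wA mul0mx.
  move: wAJ; rewrite mulmxDl -!scalemxAl Jv0 Jv1 => wAJ.
  (* Subtracting [lam 0] times the relation from its image under [J] leaves
     only the second eigenvector. *)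
  have : (lam 1 - lam 0) *: (w 0 1 *: v1) = 0.
    rewrite scalerBl -[RHS](subrr 0) -{1}wAJ -[in RHS](scaler0 _ (lam 0)) -wA.
    rewrite scalerDr !scalerA ![w 0 _ * _]mulrC opprD addrACA subrr add0r.
    by [].
  move/eqP; rewrite !scaler_eq0 subr_eq0 eq_sym (negPf lam01) (negPf v1_neq0)
    orbF /= => /eqP w1.
  move/eqP: wA; rewrite w1 scale0r addr0 scaler_eq0 (negPf v0_neq0) orbF => /eqP w0.
  move/negP: w_neq0; apply; apply/eqP/rowP => -[[|[|//]] hl]; rewrite mxE.
    by rewrite -w0; congr (w 0 _); apply: val_inj.
  by rewrite -w1; congr (w 0 _); apply: val_inj.
exists A => //; suff -> : A *m J = diag_mx (\row_k lam k) *m A by rewrite mulmxK.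
apply/row_matrixP => k; rewrite row_mul.
have -> : row k (diag_mx (\row_k lam k) *m A) = lam k *: row k A.
  by apply/rowP => l; rewrite mul_diag_mx !mxE.
case: k => [[|[|//]] hk].
  have -> : row (Ordinal hk) A = v0 by apply/rowP => l; rewrite !mxE.
  by rewrite Jv0; congr (lam _ *: _); apply: val_inj.
have -> : row (Ordinal hk) A = v1 by apply/rowP => l; rewrite !mxE.
by rewrite Jv1; congr (lam _ *: _); apply: val_inj.
Qed.

Lemma exists_pd_form (K : fieldType) (lam : 'I_2 -> K) (F : fmap2 K) :
    fixes0 F -> (forall k, eigenvalue (jacobian F) (lam k)) -> lam 0 != lam 1 ->
  exists G, is_pd_form lam F G.
Proof.
move=> F0 Flam lam01; have [A uA JA] := diagonalize2 Flam lam01.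
have LA0 : fixes0 (lin_map A) by [].
have AF0 := fixes0_comp LA0 F0.
have F'0 : fixes0 (lin_conj A F) by apply: fixes0_comp.
exists (pd_form lam (lin_conj A F)), A, (fun m => pd_iter lam (lin_conj A F) m.-1).
split=> //.
- by rewrite /lin_conj !jacobian_comp// !jacobian_lin.
- exact: pd_sequence_iter.
- move=> k i j; exists (i + j).+1 => -[//|m] ijm.
  have aF n k' := @pd_iter_agree K lam (lin_conj A F) n k' F'0.
  by rewrite /pd_form [RHS](formal_lim_agree aF (n := m)).
Qed.

(** The divisors are differences of powers of [lam], and distinct powers have
distinct norms because [norm lam] is not [1]. *)
Lemma no_small_divisors_eigen_pair (R : realType) (K : fieldType) (norm : K -> R)
    (Knorm : nonarch_norm norm) (lam : K) : lam != 0 -> norm lam != 1 ->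
  no_small_divisors norm (eigen_pair 1 lam).
Proof.
move=> lam0 lam1 k i j d0; apply: (norm_sub_neq Knorm).
have nlam0 : 0 < norm lam by apply: norm_gt0.
have inj : injective (GRing.exp (norm lam)) := ieexprIn nlam0 lam1.
apply: contraNneq d0; rewrite /eigen_pair /= expr1n mul1r (normX Knorm).
case: ifP => _.
  by rewrite (norm1 Knorm) -(expr0 (norm lam)) => /inj <-; rewrite expr0 subrr.
by rewrite -{1}(expr1 (norm lam)) => /inj <-; rewrite expr1 subrr.
Qed.

Theorem proposition5p4 (R : realType) (K : fieldType) (norm : K -> R)
  (Knorm : nonarch_norm norm) (Knontrivial : nontrivially_valued norm)
  (Kcomplete : complete_norm norm) (Kchar0 : [pchar K] =i pred0)
  (lam : K) (lam_neq0 : lam != 0) (lam_norm : norm lam != 1)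
  (F : fmap2 K) (Ffix : fixes0 F) (Fan : analytic0 norm F)
  (Feigen1 : eigenvalue (jacobian F) 1)
  (Feigen2 : eigenvalue (jacobian F) lam) :
  (exists G : fmap2 K, is_pd_form (eigen_pair 1 lam) F G) /\
  (forall G : fmap2 K, is_pd_form (eigen_pair 1 lam) F G ->
     analytically_equivalent norm F G).
Proof.
split=> [|G FG].
  apply: exists_pd_form => // [k|]; first by rewrite /eigen_pair; case: ifP.
  by apply: contra_neq lam_norm => /esym; rewrite /eigen_pair /= => ->; apply: norm1 Knorm.
apply: analytically_equivalent_pd_form FG => //.
  by move=> k; rewrite /eigen_pair; case: ifP => // _; exact: oner_neq0.
exact: no_small_divisors_eigen_pair.
Qed.
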